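(* Let $\ast$ be a binary operation on $I=[0,1]$ and let $\Delta$ be a t-norm on $I$. Then the following statements are equivalent: (1) $\widetilde{\Delta}_{\ast}$ satisfies axiom (O5), i.e. $\bm{1}_{[0,1]}\,\widetilde{\Delta}_{\ast}\,\bm{1}_{[a,b]}=\bm{1}_{[0,b]}$ for all $0\le a\le b\le 1$; (2) $1\ast 0=0$, $1\ast 1=1$, and the function $I\to I$, $x\mapsto x\Delta b$, is continuous for all $b\in I$; (3) $1\ast 0=0$, $1\ast 1=1$, and $\Delta$ is a continuous t-norm.
   Context: Let $I=[0,1]$ and let $\mathbf{M}$ be the set of all maps $I\to I$. For $B\subseteq I$, $\bm{1}_B\in\mathbf{M}$ is the characteristic function of $B$. A t-norm on $I$ is a binary operation $I^2\to I$ that is commutative, associative, increasing (non-decreasing) in each argument, and has neutral element $1$. Given a binary operation $\ast:I^2\to I$ (arbitrary) and a t-norm $\Delta$ on $I$, the binary operation $\widetilde{\Delta}_{\ast}:\mathbf{M}^2\to\mathbf{M}$ is defined by $$(f\,\widetilde{\Delta}_{\ast}\,g)(x)=\sup\{f(y)\ast g(z)\mid y,z\in I,\ y\Delta z=x\},\qquad f,g\in\mathbf{M},\ x\in I.$$ *)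

(* Defs.v *)
From HB Require Import structures.
From mathcomp Require Import all_boot all_order all_algebra.
From mathcomp Require Import all_classical reals topology normedtype.

Set Implicit Arguments.
Unset Strict Implicit.
Unset Printing Implicit Defensive.

Import Order.TTheory GRing.Theory Num.Theory.
Import numFieldNormedType.Exports.

Local Open Scope classical_set_scope.
Local Open Scope ring_scope.

(* The topology is the one induced by the inclusion in R; on pairs of points
   the product topology is then inferred. *)
Definition unitI (R : realType) : topologicalType :=
  set_type (`[0, 1]%classic : set R).

Definition valI (R : realType) (x : unitI R) : R := set_val x.

Lemma unitI0_subproof (R : realType) : (0 : R) \in (`[0, 1]%classic : set R).
Proof. by rewrite inE /= in_itv /= lexx ler01. Qed.

Lemma unitI1_subproof (R : realType) : (1 : R) \in (`[0, 1]%classic : set R).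
Proof. by rewrite inE /= in_itv /= lexx ler01. Qed.

Definition zeroI (R : realType) : unitI R := exist _ 0 (unitI0_subproof R).
Definition oneI (R : realType) : unitI R := exist _ 1 (unitI1_subproof R).

Lemma supI_subproof (R : realType) (A : set (unitI R)) :
  sup [set valI x | x in A] \in (`[0, 1]%classic : set R).
Proof.
have vP (x : unitI R) : 0 <= valI x <= 1.
  by have := set_valP x; rewrite /= in_itv.
rewrite inE /= in_itv /=.
have [->|/set0P [a Aa]] := eqVneq A set0.
  by rewrite image_set0 sup0 lexx ler01.
have ub1 : ubound [set valI x | x in A] 1.
  by move=> _ [x _ <-]; case/andP: (vP x).
have ne : [set valI x | x in A] !=set0 by exists (valI a), a.
apply/andP; split; last exact: ge_sup.
case/andP: (vP a) => a0 _; apply: (le_trans a0).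
by apply: ub_le_sup; [exists 1 | exists a].
Qed.

(* Supremum in the complete lattice [0, 1]; since [sup set0 = 0], this is also
   correct for the empty set. *)
Definition supI (R : realType) (A : set (unitI R)) : unitI R :=
  exist _ (sup [set valI x | x in A]) (supI_subproof A).

Definition charI (R : realType) (B : set (unitI R)) : unitI R -> unitI R :=
  fun x => if x \in B then oneI R else zeroI R.

Definition segI (R : realType) (a b : unitI R) : set (unitI R) :=
  [set x | valI a <= valI x <= valI b].

Record is_tnorm (R : realType) (T : unitI R -> unitI R -> unitI R) : Prop := {
  tnormC : forall x y, T x y = T y x;
  tnormA : forall x y z, T (T x y) z = T x (T y z);
  tnorm_lel : forall x x' y, valI x <= valI x' -> valI (T x y) <= valI (T x' y);
  tnorm_ler : forall x y y', valI y <= valI y' -> valI (T x y) <= valI (T x y');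
  tnorm1 : forall x, T (oneI R) x = x /\ T x (oneI R) = x
}.

Definition continuous_op (R : realType) (T : unitI R -> unitI R -> unitI R) :=
  continuous (fun p : unitI R * unitI R => T p.1 p.2).

Definition convolution (R : realType) (star T : unitI R -> unitI R -> unitI R)
    (f g : unitI R -> unitI R) : unitI R -> unitI R :=
  fun x => supI [set w | exists y z : unitI R,
                           T y z = x /\ w = star (f y) (g z)].

Definition axiom_O5 (R : realType)
    (op : (unitI R -> unitI R) -> (unitI R -> unitI R) ->
          (unitI R -> unitI R)) : Prop :=
  forall a b : unitI R, valI a <= valI b ->
    op (charI (segI (zeroI R) (oneI R))) (charI (segI a b)) =
    charI (segI (zeroI R) b).

(* Main.v *)
Require Import Defs.
From mathcomp Require Import all_boot all_order all_algebra.
From mathcomp Require Import all_classical reals topology normedtype.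
From mathcomp Require Import lra.

Set Implicit Arguments.
Unset Strict Implicit.
Unset Printing Implicit Defensive.

Import Order.TTheory GRing.Theory Num.Theory.
Import numFieldNormedType.Exports.

Local Open Scope classical_set_scope.
Local Open Scope ring_scope.

(** The three statements meet in one property of the t-norm: each translation
    [y |-> T y b] reaches every value between its end values.  As
    [T 0 b = 0] and [T 1 b = b], this says that it maps [0, 1] onto [0, b].

    Axiom (O5) forces this property.  Take [a = b].  The value at [x] of the
    convolution of the two indicators is the supremum of all [1 * 1] and
    [1 * 0] given by the pairs [y, z] with [T y z = x], where [1 * 1] appears
    only if [z = b].  Evaluating (O5) at [x = 1] for [0, 0] and for [0, 1]
    gives [1 * 0 = 0] and [1 * 1 = 1]; then for [x <= b] the supremum can be
    [1] only if some [y] satisfies [T y b = x] ([O5_ivpI]).  Conversely, if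
    such [y] exist then the convolution is [1] on [0, b], and it is [0] beyond
    [b] because [T y z <= z] ([ivpI_O5]).

    Continuity enters through monotonicity.  A continuous map of [0, 1] has
    the property by the intermediate value theorem ([continuous_ivpI]), and
    for a monotone map the property implies continuity: the values slightly
    above and below [f x] are attained on both sides of [x].  With the second
    argument also moving, the same bracketing gives joint continuity of a
    monotone operation from continuity in each argument
    ([monotone_continuous_op]). *)

(** * Topology of the unit interval *)

Section UnitInterval.
Variable R : realType.
Implicit Types (x y z b : unitI R) (f : unitI R -> unitI R).

Lemma valI_inj : injective (@valI R).
Proof. exact: val_inj. Qed.

Lemma valI_itv x : 0 <= valI x <= 1.
Proof. by have := set_valP x; rewrite /= in_itv. Qed.

Lemma valI_surj (r : R) : 0 <= r <= 1 -> exists x, valI x = r.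
Proof.
move=> r01; have rI : r \in (`[0, 1]%classic : set R) by rewrite inE /= in_itv.
by exists (exist _ r rI).
Qed.

Lemma continuous_valI : continuous (@valI R).
Proof. exact: initial_continuous. Qed.

Lemma continuous_intoI (X : topologicalType) (g : X -> unitI R) :
  continuous (@valI R \o g) -> continuous g.
Proof. exact: continuous_comp_initial. Qed.

Lemma clampI_subproof (r : R) :
  Num.max 0 (Num.min 1 r) \in (`[0, 1]%classic : set R).
Proof.
by rewrite inE /= in_itv /= le_max lexx ge_max ler01 ge_min lexx.
Qed.

(** A continuous retraction of the line onto [0, 1]: it turns a map on the
    subtype into a map on the reals, to which the intermediate value theorem
    for real functions applies. *)
Definition clampI (r : R) : unitI R :=
  exist _ (Num.max 0 (Num.min 1 r)) (clampI_subproof r).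

Lemma clampIK x : clampI (valI x) = x.
Proof.
apply: valI_inj; have /andP[x0 x1] := valI_itv x.
by transitivity (Num.max 0 (Num.min 1 (valI x))); rewrite // min_r // max_r.
Qed.

Lemma continuous_clampI : continuous clampI.
Proof.
apply: continuous_intoI => r; apply: (@continuous_max R R).
  exact: cvg_cst.
by apply: (@continuous_min R R); [exact: cvg_cst | exact: cvg_id].
Qed.

(** * Monotone maps and intermediate values *)

Definition monotoneI f :=
  forall x y, valI x <= valI y -> valI (f x) <= valI (f y).

Definition ivpI f :=
  forall w, valI (f (zeroI R)) <= valI w <= valI (f (oneI R)) ->
  exists x, f x = w.

Lemma continuous_ivpI f : continuous f -> ivpI f.
Proof.
move=> cf w /andP[w0 w1].
have cg : continuous (valI (R:=R) \o f \o clampI).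
  move=> r; apply: continuous_comp; first exact: continuous_clampI.
  by apply: continuous_comp; [exact: cf | exact: continuous_valI].
have [|||c _ /= fc] := @IVT R (valI (R:=R) \o f \o clampI) 0 1 (valI w).
- exact: ler01.
- exact: continuous_subspaceT.
- rewrite /= -[0]/(valI (zeroI R)) -[1]/(valI (oneI R)) !clampIK.
  by rewrite ge_min le_max w0 w1 orbT.
by exists (clampI c); apply: valI_inj.
Qed.

Lemma monotoneI_lt f x y :
  monotoneI f -> valI (f x) < valI (f y) -> valI x < valI y.
Proof. by move=> mf; rewrite !ltNge; apply: contra => /mf. Qed.

(** The map [f] cannot jump at [x] from below: a value strictly between [c] and
    [f x] is attained, by monotonicity at a point [y] left of [x], and then the
    points right of [y] form a neighbourhood of [x].  When [c] lies below
    [f 0] such a value may not exist, but then the left end point serves as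
    [y]. *)
Lemma ivpI_near_ge f x (c : R) : monotoneI f -> ivpI f -> c < valI (f x) ->
  exists2 y, \forall z \near x, valI y <= valI z & c < valI (f y).
Proof.
move=> mf onf cx; have [c0|c0] := ltP c (valI (f (zeroI R))).
  exists (zeroI R) => //; apply: (@filterE _ (nbhs x)) => z.
  by case/andP: (valI_itv z).
have fx1 : valI (f x) <= valI (f (oneI R)).
  by apply: mf; case/andP: (valI_itv x).
have [w wE] : exists w : unitI R, valI w = (c + valI (f x)) / 2.
  apply: valI_surj; have /andP[? ?] := valI_itv (f (zeroI R)).
  by have /andP[? ?] := valI_itv (f x); lra.
have [|y fy] := onf w; first by rewrite wE; lra.
exists y; last by rewrite fy wE; lra.
have yx : valI y < valI x by apply: (monotoneI_lt mf); rewrite fy wE; lra.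
apply: (@filterS _ (nbhs x) _ _ _ (fun z => @ltW _ _ _ _)).
exact: (cvgr_gt _ (continuous_valI (x:=x))).
Qed.

Lemma ivpI_near_le f x (c : R) : monotoneI f -> ivpI f -> valI (f x) < c ->
  exists2 y, \forall z \near x, valI z <= valI y & valI (f y) < c.
Proof.
move=> mf onf cx; have [c1|c1] := ltP (valI (f (oneI R))) c.
  exists (oneI R) => //; apply: (@filterE _ (nbhs x)) => z.
  by case/andP: (valI_itv z).
have fx0 : valI (f (zeroI R)) <= valI (f x).
  by apply: mf; case/andP: (valI_itv x).
have [w wE] : exists w : unitI R, valI w = (valI (f x) + c) / 2.
  apply: valI_surj; have /andP[? ?] := valI_itv (f (oneI R)).
  by have /andP[? ?] := valI_itv (f x); lra.
have [|y fy] := onf w; first by rewrite wE; lra.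
exists y; last by rewrite fy wE; lra.
have yx : valI x < valI y by apply: (monotoneI_lt mf); rewrite fy wE; lra.
apply: (@filterS _ (nbhs x) _ _ _ (fun z => @ltW _ _ _ _)).
exact: (cvgr_lt _ (continuous_valI (x:=x))).
Qed.

(** The point [x] near [x0] is enclosed between two fixed points [a] and [b]
    with [T a y0] and [T b y0] close to [T x0 y0].  Monotonicity gives
    [T a y <= T x y <= T b y], so that continuity in [y] is needed for the two
    values [a] and [b] only, and one neighbourhood of [y0] serves all [x]. *)
Lemma monotone_continuous_op (T : unitI R -> unitI R -> unitI R) :
  (forall y, monotoneI (T^~ y)) -> (forall y, ivpI (T^~ y)) ->
  (forall x, continuous (T x)) -> continuous_op T.
Proof.
move=> mT onT cT; apply: continuous_intoI => -[x0 y0].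
apply/cvgrPdist_lt => e e0 /=; set c := valI (T x0 y0).
have [|a ax ca] := @ivpI_near_ge _ x0 (c - e) (mT y0) (onT y0).
  by rewrite -/c; lra.
have [|b bx cb] := @ivpI_near_le _ x0 (c + e) (mT y0) (onT y0).
  by rewrite -/c; lra.
have vT x : valI (T x y) @[y --> y0] --> valI (T x y0).
  by apply: continuous_comp; [exact: cT | exact: continuous_valI].
have ay : \forall y \near y0, c - e < valI (T a y) by exact: (cvgr_gt _ (vT a)).
have yb : \forall y \near y0, valI (T b y) < c + e by exact: (cvgr_lt _ (vT b)).
exists ([set x | valI a <= valI x /\ valI x <= valI b],
  [set y | c - e < valI (T a y) /\ valI (T b y) < c + e]).
  by split => /=; apply: filterI.
move=> [x y] /= [[ax' xb'] [ay' yb']].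
have l1 := mT y _ _ ax'; have l2 := mT y _ _ xb'.
by rewrite ltr_norml; lra.
Qed.

(** A map of one variable is an operation constant in its second argument. *)
Lemma monotone_ivpI_continuous f : monotoneI f -> ivpI f -> continuous f.
Proof.
move=> mf onf x.
have cf : continuous_op (fun x _ : unitI R => f x).
  by apply: monotone_continuous_op => // y; exact: cst_continuous.
exact: (@cvg_comp _ _ _ (fun y => (y, zeroI R)) _ _ _ _
  (cvg_pair cvg_id (cvg_cst (zeroI R))) (cf (x, zeroI R))).
Qed.

(** * Indicators and suprema in the unit interval *)

Lemma oneI_neq0 : oneI R <> zeroI R.
Proof. by move=> /(congr1 (@valI R))/eqP; rewrite oner_eq0. Qed.

Lemma charI_full x : charI (segI (zeroI R) (oneI R)) x = oneI R.
Proof. by rewrite /charI mem_set //; exact: valI_itv. Qed.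

Lemma charIT (B : set (unitI R)) x : B x -> charI B x = oneI R.
Proof. by move=> Bx; rewrite /charI mem_set. Qed.

Lemma charIF (B : set (unitI R)) x : ~ B x -> charI B x = zeroI R.
Proof. by move=> Bx; rewrite /charI memNset. Qed.

Lemma supI_set1 x : supI [set x] = x.
Proof.
apply: valI_inj; transitivity (sup [set valI y | y in [set x]]) => //.
by rewrite image_set1 sup1.
Qed.

Lemma supI_all_eq (A : set (unitI R)) x :
  A !=set0 -> (forall y, A y -> y = x) -> supI A = x.
Proof.
move=> [y Ay] Ax; rewrite -[RHS]supI_set1; congr supI.
by apply/seteqP; split => [z /Ax //|_ ->]; rewrite -(Ax _ Ay).
Qed.

Lemma supI_one (A : set (unitI R)) : A (oneI R) -> supI A = oneI R.
Proof.
move=> A1; apply: valI_inj; apply/eqP; rewrite eq_le; apply/andP; split.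
  by case/andP: (valI_itv (supI A)).
apply: ub_le_sup; last by exists (oneI R).
by exists 1 => _ [y _ <-]; case/andP: (valI_itv y).
Qed.

End UnitInterval.

(** * T-norms and axiom (O5) *)

Section TNorm.
Variables (R : realType) (T : unitI R -> unitI R -> unitI R).
Hypothesis hT : is_tnorm T.
Implicit Types x y z b : unitI R.

Lemma tnorm_le_right x y : valI (T x y) <= valI y.
Proof.
rewrite -[in leRHS](proj1 (tnorm1 hT y)).
by apply: (tnorm_lel hT); case/andP: (valI_itv x).
Qed.

Lemma tnorm0l y : T (zeroI R) y = zeroI R.
Proof.
apply: valI_inj; apply/eqP; rewrite eq_le; apply/andP; split.
  by rewrite (tnormC hT); exact: tnorm_le_right.
by case/andP: (valI_itv (T (zeroI R) y)).
Qed.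

Lemma tnorm_ivpI b :
  ivpI (T^~ b) <-> forall x, valI x <= valI b -> exists y, T y b = x.
Proof.
have b0 : T (zeroI R) b = zeroI R by exact: tnorm0l.
have b1 : T (oneI R) b = b by exact: (proj1 (tnorm1 hT b)).
split => [ivT x xb|onT x]; last by rewrite b1 => /andP[_ /onT].
by apply: ivT; rewrite b0 b1 xb andbT; case/andP: (valI_itv x).
Qed.

Lemma tnorm_eq1r y z : T y z = oneI R -> z = oneI R.
Proof.
move=> yz; apply: valI_inj; apply/eqP; rewrite eq_le; apply/andP; split.
  by case/andP: (valI_itv z).
by rewrite -yz; exact: tnorm_le_right.
Qed.

Variable star : unitI R -> unitI R -> unitI R.

Lemma convolution_fullE (B : set (unitI R)) x :
  convolution star T (charI (segI (zeroI R) (oneI R))) (charI B) x =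
  supI [set w | exists y z, T y z = x /\ w = star (oneI R) (charI B z)].
Proof.
by congr supI; apply/seteqP; split => w [y [z [yz ->]]]; exists y, z;
  rewrite charI_full.
Qed.

(** Both values are read off at [x = 1], where the supremum has one element.
    For the point interval [0, 0] it is [1 * 0], because [T y z = 1] forces
    [z = 1]; for the full interval it is [1 * 1]. *)
Lemma O5_star : axiom_O5 (convolution star T) ->
  star (oneI R) (zeroI R) = zeroI R /\ star (oneI R) (oneI R) = oneI R.
Proof.
have lt01 : valI (zeroI R) < valI (oneI R) by exact: ltr01.
have T11 : T (oneI R) (oneI R) = oneI R by exact: (proj1 (tnorm1 hT _)).
move=> O5; split.
  have := congr1 (@^~ (oneI R)) (O5 _ _ (lexx (valI (zeroI R)))).
  have n1 : ~ segI (zeroI R) (zeroI R) (oneI R).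
    by rewrite /segI /= => /andP[_]; rewrite leNgt lt01.
  rewrite /= convolution_fullE charIF // => E; apply: etrans E.
  apply/esym/supI_all_eq.
    by exists (star (oneI R) (zeroI R)), (oneI R), (oneI R); rewrite charIF.
  by move=> _ [y [z [/tnorm_eq1r -> ->]]]; rewrite charIF.
have := congr1 (@^~ (oneI R)) (O5 _ _ (ltW lt01)).
rewrite /= convolution_fullE charI_full => E; apply: etrans E.
apply/esym/supI_all_eq.
  by exists (star (oneI R) (oneI R)), (oneI R), (oneI R); rewrite charI_full.
by move=> _ [y [z [_ ->]]]; rewrite charI_full.
Qed.

(** If [x <= b] were not of the form [T y b], then no pair [y, z] with
    [T y z = x] would have [z = b], and the supremum that (O5) for [b, b]
    equates with [1] would range over the single value [1 * 0 = 0]. *)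
Lemma O5_ivpI b : axiom_O5 (convolution star T) -> ivpI (T^~ b).
Proof.
move=> O5; have [s0 _] := O5_star O5; apply/tnorm_ivpI => x xb.
apply: contrapT => nx; apply: (@oneI_neq0 R).
have := congr1 (@^~ x) (O5 _ _ (lexx (valI b))).
have xS : segI (zeroI R) b x.
  by rewrite /segI /= xb andbT; case/andP: (valI_itv x).
rewrite /= convolution_fullE (charIT xS) => /esym E.
apply: (etrans E); apply: supI_all_eq.
  by exists (star (oneI R) (charI (segI b b) x)), (oneI R), x;
    rewrite (proj1 (tnorm1 hT x)).
move=> _ [y [z [yz ->]]]; rewrite charIF // => /le_anti bz.
by apply: nx; exists y; rewrite (valI_inj bz).
Qed.

(** For [x <= b] the supremum is attained at a pair [y, b]; for [x > b] every
    pair has [z >= T y z = x > b], outside of [a, b]. *)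
Lemma ivpI_O5 :
  star (oneI R) (zeroI R) = zeroI R -> star (oneI R) (oneI R) = oneI R ->
  (forall b, ivpI (T^~ b)) -> axiom_O5 (convolution star T).
Proof.
move=> s0 s1 onT a b ab; apply/funext => x; rewrite convolution_fullE.
have [xb|bx] := leP (valI x) (valI b).
  rewrite [RHS]charIT; last first.
    by rewrite /segI /= xb andbT; case/andP: (valI_itv x).
  have [y yb] := (tnorm_ivpI b).1 (onT b) x xb.
  by apply: supI_one; exists y, b; rewrite charIT // /segI /= ab lexx.
have above z : valI x <= valI z -> ~ segI a b z.
  by move=> xz /andP[_]; rewrite leNgt (lt_le_trans bx).
rewrite [RHS]charIF; last by move=> /andP[_]; rewrite leNgt bx.
apply: supI_all_eq.
  by exists (star (oneI R) (charI (segI a b) x)), (oneI R), x;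
    rewrite (proj1 (tnorm1 hT x)).
move=> _ [y [z [yz ->]]]; rewrite charIF //; apply: above.
by rewrite -yz; exact: tnorm_le_right.
Qed.

End TNorm.

Theorem theorem9 (R : realType) (star T : unitI R -> unitI R -> unitI R)
    (hT : is_tnorm T) :
  [<-> axiom_O5 (convolution star T);
       [/\ star (oneI R) (zeroI R) = zeroI R,
           star (oneI R) (oneI R) = oneI R &
           forall b : unitI R, continuous (fun x : unitI R => T x b)];
       [/\ star (oneI R) (zeroI R) = zeroI R,
           star (oneI R) (oneI R) = oneI R &
           continuous_op T]].
Proof.
have mT b : monotoneI (T^~ b) by move=> x y; exact: (tnorm_lel hT).
tfae.
- move=> O5; have [s0 s1] := O5_star hT O5; split=> // b.
  by apply: (monotone_ivpI_continuous (mT b)); apply: (O5_ivpI hT O5).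
- move=> [s0 s1 cT]; split=> //; apply: monotone_continuous_op => // x.
    exact: continuous_ivpI.
  have -> : T x = T^~ x by apply/funext => y; rewrite (tnormC hT).
  exact: cT.
- move=> [s0 s1 cT]; apply: ivpI_O5 => // b; apply: continuous_ivpI => x.
  exact: (@cvg_comp _ _ _ (fun y => (y, b)) _ _ _ _
    (cvg_pair cvg_id (cvg_cst b)) (cT (x, b))).
Qed.
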